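(* Let $q$ be a prime power and $n$ a positive integer. Let $L_0,L_1$ be $q^2$-linear polynomials over $\mathbb F_{q^{2n}}$ of degree less than $q^{2n}$, let $C_0$ and $C_1$ be coefficient matrices of $\sigma_{L_0}$ and $\sigma_{L_1}$ respectively (with respect to some bases), and suppose both $C_0$ and $C_1$ are nonsingular. Then the following are equivalent: (1) $\sigma_{L_0}$ and $\sigma_{L_1}$ are equivalent; (2) $C_0^*C_0^{-1}$ and $C_1^*C_1^{-1}$ are conjugate in $\mathrm{GL}_n(q^2)$; (3) $PM_{L_0}^*M_{L_0}^{-1}$ and $PM_{L_1}^*M_{L_1}^{-1}$ are conjugate in $\mathrm{GL}_n(q^{2n})$.
   Context: $\mathrm{Tr}$ is the trace $\mathbb F_{q^{2n}}\to\mathbb F_{q^2}$, and for a $q^2$-linear polynomial $L$, $\sigma_L(u,v)=\mathrm{Tr}(uL(v^q))$, a sesquilinear form of $\mathbb F_{q^{2n}}/\mathbb F_{q^2}$ (linear in the first argument, semilinear w.r.t. $x\mapsto x^q$ in the second). Two sesquilinear forms $\sigma,\sigma'$ are equivalent if there is an $\mathbb F_{q^2}$-linear automorphism $\tau$ of $\mathbb F_{q^{2n}}$ with $\sigma(u,v)=\sigma'(\tau(u),\tau(v))$ for all $u,v$. The coefficient matrix of $\sigma$ w.r.t. a basis $\beta_1,\dots,\beta_n$ of $\mathbb F_{q^{2n}}/\mathbb F_{q^2}$ has $(i,j)$ entry $\sigma(\beta_i,\beta_j)$. For a matrix $M$, $M^*$ is the transpose of $M$ with every entry raised to the $q$-th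 power. For $L(x)=\sum_{i=0}^{n-1}a_ix^{q^{2i}}$, $M_L$ is the $n\times n$ matrix whose $(i,j)$ entry ($1\le i,j\le n$) is $a_{(j-i)\bmod n}^{q^{2(i-1)}}$, i.e. row $i$ is the $(i-1)$-fold cyclic right shift of $(a_0,\dots,a_{n-1})$ with entries raised to the $q^{2(i-1)}$ power. $P$ is the $n\times n$ permutation matrix with entries $1$ in positions $(1,n)$ and $(i+1,i)$ for $1\le i\le n-1$, and $0$ elsewhere. $\mathrm{GL}_n(Q)$ denotes the group of nonsingular $n\times n$ matrices over $\mathbb F_Q$. *)

(* Defs.v *)
From mathcomp Require Import all_boot all_order all_algebra all_field.
Set Implicit Arguments. Unset Strict Implicit. Unset Printing Implicit Defensive.
Import GRing.Theory.
Local Open Scope ring_scope.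

(* Setting: L is a finite field with #|L| = q^(2n), playing F_{q^{2n}};
   the subfield F_{q^2} is {x | x^(q^2) = x}. *)

Section Defs.
Variables (F : finFieldType) (q n : nat).

Definition inFq2 (x : F) : bool := x ^+ (q ^ 2) == x.

Definition Tr (x : F) : F := \sum_(i < n) x ^+ (q ^ (2 * i)).

(* the q^2-linear polynomial L(x) = sum_{i<n} a_i x^{q^{2i}}
   (coefficients a_0..a_{n-1}; values of a at indices >= n are unused) *)
Definition Lpoly (a : nat -> F) (x : F) : F :=
  \sum_(i < n) a i * x ^+ (q ^ (2 * i)).

Definition sigmaL (a : nat -> F) (u v : F) : F := Tr (u * Lpoly a (v ^+ q)).

Definition is_basis_Fq2 (b : 'I_n -> F) : Prop :=
  (forall c : 'I_n -> F, (forall i, inFq2 (c i)) ->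
     \sum_(i < n) c i * b i = 0 -> forall i, c i = 0) /\
  (forall x : F, exists2 c : 'I_n -> F, (forall i, inFq2 (c i)) &
     x = \sum_(i < n) c i * b i).

Definition coefmx (a : nat -> F) (b : 'I_n -> F) : 'M[F]_n :=
  \matrix_(i, j) sigmaL a (b i) (b j).

Definition mxstar (M : 'M[F]_n) : 'M[F]_n := map_mx (fun x => x ^+ q) M^T.

Definition ML (a : nat -> F) : 'M[F]_n :=
  \matrix_(i, j) a ((j + n - i) %% n)%N ^+ (q ^ (2 * i)).

(* P: ones at (1,n) and (i+1,i) (1-based); 0-based: (i,j) with i = (j+1) mod n *)
Definition Pmx : 'M[F]_n :=
  \matrix_(i, j) (if (i == (j.+1 %% n)%N :> nat) then 1 else 0).

Definition sesq_equiv (a0 a1 : nat -> F) : Prop :=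
  exists tau : F -> F,
    [/\ bijective tau,
        (forall x y, tau (x + y) = tau x + tau y),
        (forall c x, inFq2 c -> tau (c * x) = c * tau x) &
        (forall u v, sigmaL a0 u v = sigmaL a1 (tau u) (tau v))].

Definition conj_in (S : F -> bool) (A B : 'M[F]_n) : Prop :=
  exists2 X : 'M[F]_n, (X \in unitmx) /\ (forall i j, S (X i j)) &
    X *m A *m invmx X = B.

End Defs.

(* Main.v *)
(** Let [B] be the Moore matrix [(b_i^(q^(2k)))] of a basis. Since
    [sigma_L(u,v)] is a bilinear expression in the conjugates of [u] and [v^q],
    [C = B M_L B^*] and [C^* = (B P) M_L^* B^*], so
    [C^* C^-1 = B (P M_L^* M_L^-1) B^-1]. This links (2) and (3) once one knows
    that matrices over F_{q^2} that are conjugate over F_{q^(2n)} are conjugate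
    over F_{q^2}. That descent is obtained by Lovasz's counting argument: an
    endomorphism [V] is determined up to conjugacy by the number of intertwiners
    [X] with [U X = X V], for all [U], and these numbers are powers of the field
    size whose exponents are ranks, insensitive to field extension.

    For (2) => (1), one may assume [C0^* C0^-1 = C1^* C1^-1]. Then
    [D = C1 C0^-1] is fixed by the anti-automorphism [M |-> C0 M^* C0^-1], which
    restricts to an involution [s] of the bicommutant of [D], a finite
    commutative ring. There, Hilbert 90 and a count show that every unit fixed by
    [s] is a norm [y s(y)]; writing [D] so gives [C1 = y C0 y^*]. *)
Require Import Defs.
From HB Require Import structures.
From mathcomp Require Import all_boot all_order all_algebra all_field.
From mathcomp Require Import all_fingroup mxabelem ring.
Set Implicit Arguments. Unset Strict Implicit. Unset Printing Implicit Defensive.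
Import GRing.Theory.
Local Open Scope ring_scope.

(** * Norms in finite commutative rings with involution *)

(** The powers of [x] become periodic, with preperiod and period at most [#|R|]. The factorial of
    [#|R|] is at least the preperiod and a multiple of the period, so one exponent serves all
    [x]. *)
Lemma finite_idem_exponent (R : finNzRingType) (x : R) :
  x ^+ #|R|`! * x ^+ #|R|`! = x ^+ #|R|`!.
Proof.
have /injectivePn [i [j nij eq_ij]] :
    ~~ injectiveb (fun i : 'I_#|R|.+1 => x ^+ i).
  apply/negP => /injectiveP inj.
  by have := leq_card _ inj; rewrite card_ord ltnn.
wlog lt_ij : i j nij eq_ij / (i < j)%N.
  move=> W; have := nij; rewrite neq_ltn => /orP[] lt_ij; first exact: (W i j).
  by apply: (W j i) => //; rewrite eq_sym.
have per m t : (i <= m)%N -> x ^+ (m + t * (j - i)) = x ^+ m.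
  move=> le_im; elim: t => [|t IH]; first by rewrite addn0.
  rewrite mulSn addnCA exprD IH -exprD -{1}(subnK le_im) addnCA.
  by rewrite subnK ?(ltnW lt_ij) // exprD -eq_ij -exprD subnK.
have /dvdnP[t def_k] : (j - i %| #|R|`!)%N.
  apply: dvdn_fact; rewrite subn_gt0 lt_ij /=.
  by rewrite (leq_trans (leq_subr _ _)) // -ltnS.
rewrite -exprD {2}def_k; apply: per.
by rewrite (leq_trans _ (fact_geq _)) // (leq_trans (ltnW lt_ij)) // -ltnS.
Qed.

Lemma nilpotentD (R : comNzRingType) (x y : R) k :
  x ^+ k = 0 -> y ^+ k = 0 -> (x + y) ^+ (k + k) = 0.
Proof.
move=> xk yk; rewrite exprDn big1 // => i _.
have [le_ki|lt_ik] := leqP k i.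
  by rewrite -(subnK le_ki) [y ^+ _]exprD yk !mulr0 mul0rn.
have le : (k <= k + k - i)%N by rewrite -addnBA ?leq_addr // ltnW.
by rewrite -(subnK le) exprD xk mulr0 mul0r mul0rn.
Qed.

Section FiniteInvolution.
Variables (R : finComUnitRingType) (s : {rmorphism R -> R}) (al : R).
Hypotheses (sK : involutive s) (Ual : al - s al \is a GRing.unit).

Lemma hilbert90 (y : R) :
  y * s y = 1 -> exists2 z, z \is a GRing.unit & z = y * s z.
Proof.
move=> ysy; pose k := #|R|`!; have k_gt0 : (0 < k)%N by apply: fact_gt0.
have idem (x : R) : x ^+ k * x ^+ k = x ^+ k by apply: finite_idem_exponent.
(* Among the solutions of [z = y * s z], take one whose idempotent power [e] has
   the smallest annihilator. If [e <> 1], the solutions [w t], which span the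
   ideal of [u = 1 - e] together with their multiples, are not all nilpotent,
   and adding such a [w t] to [e * z] enlarges [e]. *)
have V0 : 0 == y * s 0 by rewrite rmorph0 mulr0.
case: (@arg_minnP R 0 (fun z => z == y * s z)
  (fun z => #|[set x | z ^+ k * x == 0]|) V0) => z Vz' min_z.
move/eqP: (Vz') => Vz.
set e := z ^+ k; have ee : e * e = e := idem z.
(* [e] and [s e] are idempotents that differ by the unit factor [y ^+ k], so they coincide. *)
have se : s e = e.
  have e_y : e = y ^+ k * s e by rewrite /e {1}Vz exprMn rmorphXn.
  have sy : s y ^+ k * y ^+ k = 1 by rewrite -exprMn mulrC ysy expr1n.
  have se_y : s e = s y ^+ k * e by rewrite {2}e_y mulrA sy mul1r.
  have ese : e * s e = s e by rewrite {1}se_y mulrCA ee -se_y.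
  by rewrite -[LHS]ese {1}e_y -mulrA -rmorphM ee -e_y.
pose u := 1 - e; have su : s u = u by rewrite rmorphB rmorph1 se.
have eu : e * u = 0 by rewrite mulrBr mulr1 ee subrr.
have uu : u * u = u by rewrite mulrBl mul1r eu subr0.
have uX m : (0 < m)%N -> u ^+ m = u.
  by case: m => // m _; elim: m => // m IH; rewrite exprS IH.
pose w t := u * (t + y * s t).
have Vw t : w t = y * s (w t).
  rewrite /w rmorphM su rmorphD rmorphM sK mulrCA; congr (_ * _).
  by rewrite mulrDr mulrA ysy mul1r addrC.
have w_nil t : w t ^+ k = 0.
  apply/eqP/negPn/negP => nz_w; pose v := e * z + w t.
  have ev : e * v ^+ k = e.
    have eX m : (0 < m)%N -> e ^+ m = e.
      by case: m => // m _; elim: m => // m IH; rewrite exprS IH.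
    rewrite -{1}(eX k) // -exprMn mulrDr (mulrA e e) ee (mulrA e u) eu mul0r.
    by rewrite addr0 exprMn eX.
  have uv : u * v ^+ k = w t ^+ k.
    rewrite -{1}(uX k) // -exprMn mulrDr (mulrA u e) (mulrC u) eu mul0r add0r.
    by rewrite mulrA uu.
  have Vv : v == y * s v.
    by rewrite rmorphD rmorphM se mulrDr mulrCA -Vz -Vw.
  have := min_z v Vv; rewrite leqNgt => /negP; apply.
  apply/proper_card/properP; split.
    apply/subsetP=> x; rewrite !inE => /eqP vx0.
    by rewrite -/e -ev -mulrA vx0 mulr0.
  by exists u; rewrite !inE -/e ?eu // mulrC uv.
(* The combination [w al - s al * w 1] of nilpotents equals [u * (al - s al)], and an idempotent
   times a unit is nilpotent only if the idempotent is 0. *)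
have u0 : u = 0.
  have yU : w al = u * (al - s al) + s al * w 1.
    by rewrite /w rmorph1; ring.
  have Dl : u * (al - s al) = w al + - (s al * w 1) by rewrite yU addrK.
  have : (u * (al - s al)) ^+ (k + k) = 0.
    rewrite Dl nilpotentD ?w_nil // -mulNr exprMn w_nil mulr0 //.
  rewrite exprMn uX ?addn_gt0 ?k_gt0 // => /(canRL (mulrK (unitrX _ Ual))).
  by rewrite mul0r.
exists z => //; apply: contraT => nUz.
have: z ^+ k \is a GRing.unit.
  by have/eqP := u0; rewrite subr_eq0 -/e => /eqP <-; apply: unitr1.
by rewrite unitrX_pos // (negPf nUz).
Qed.

(** Let N send [u] to [u * s u] and Q send [u] to [u / s u]. Hilbert 90 gives ker N = im Q, so im N
    has |G| / |im Q| = |ker Q| elements. As im N lies in ker Q, the group of fixed units, the two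
    are equal. *)
Lemma unit_norm_surj (d : R) :
  d \is a GRing.unit -> s d = d -> exists y, y * s y = d.
Proof.
move=> Ud sd; pose G := [set: {unit R}].
have sU (u : {unit R}) : s (val u) \is a GRing.unit by apply: rmorph_unit (valP u).
pose su u := FinRing.unit R (sU u).
have normM : {in G &, {morph (fun u => u * su u)%g : u v / (u * v)%g}}.
  by move=> u v _ _; apply: val_inj; rewrite /= rmorphM mulrACA.
have quoM : {in G &, {morph (fun u => u * (su u)^-1)%g : u v / (u * v)%g}}.
  move=> u v _ _; apply: val_inj.
  by rewrite /= rmorphM invrM ?sU // (mulrC (s (val v))^-1) mulrACA.
pose N := Morphism normM; pose Q := Morphism quoM.
have imQ : (Q @* G)%g = ('ker N)%g.
  apply/eqP; rewrite eqEsubset; apply/andP; split.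
    apply/subsetP => _ /morphimP[u _ _ ->]; apply/kerP; rewrite ?inE //.
    apply: val_inj; rewrite /= rmorphM rmorphV ?sU // sK.
    by rewrite -mulrA mulKr ?sU // divrr // (valP u).
  apply/subsetP=> y /(kerP _ (in_setT _))/(congr1 val) /= /hilbert90[z Uz Dz].
  apply/morphimP; exists (FinRing.unit R Uz); rewrite ?inE //.
  by apply: val_inj; rewrite /= {1}Dz mulrK // rmorph_unit.
have kerQ (u : {unit R}) : (u \in 'ker Q)%g = (s (val u) == val u).
  apply/(kerP Q (in_setT u))/eqP => [/(congr1 val) /= h|h].
    by rewrite -[LHS]mul1r -h divrK ?sU.
  by apply: val_inj; rewrite /= h divrr // (valP u).
have sub_im : (N @* G \subset 'ker Q)%g.
  apply/subsetP=> _ /morphimP[u _ _ ->]; rewrite kerQ /= rmorphM sK.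
  by rewrite mulrC.
have eq_im : (N @* G)%g = ('ker Q)%g.
  apply/eqP; rewrite eqEcard sub_im /=.
  have cardE (f : {morphism G >-> {unit R}}) : (#|(f @* G)%g| * #|('ker f)%g| = #|G|)%N.
    by rewrite card_morphim setIid mulnC Lagrange // subsetT.
  have := cardE Q; rewrite imQ mulnC -(cardE N) => /eqP.
  by rewrite eqn_pmul2r ?cardG_gt0 // => /eqP->.
have /morphimP[y _ _ Dd] : FinRing.unit R Ud \in (N @* G)%g.
  by rewrite eq_im kerQ /= sd.
by exists (val y); rewrite -[RHS]/(val (FinRing.unit R Ud)) Dd.
Qed.
End FiniteInvolution.

(** * Fixed fields and bicommutants *)

Section FixedField.
Variables (F : finFieldType) (f : {rmorphism F -> F}).
Definition fixp : {pred F} := fun x => f x == x.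
Fact fixp_divring : divring_closed fixp.
Proof.
split=> [|x y|x y]; rewrite !unfold_in ?rmorph1 // => /eqP fx /eqP fy.
  by rewrite rmorphB fx fy.
by rewrite fmorph_div fx fy.
Qed.
HB.instance Definition _ := GRing.isDivringClosed.Build F fixp fixp_divring.
(** Later [f] is the square of the [q]-th power map, which makes F_{q^2} a field type of its own. *)
Definition fixed := {x : F | fixp x}.
HB.instance Definition _ := SubType.on fixed.
HB.instance Definition _ := [Finite of fixed by <:].
HB.instance Definition _ := [SubChoice_isSubComUnitRing of fixed by <:].
HB.instance Definition _ := [SubComUnitRing_isSubIntegralDomain of fixed by <:].
HB.instance Definition _ := [SubIntegralDomain_isSubField of fixed by <:].
End FixedField.

Section Bicommutant.
Variables (A : finNzRingType) (d : A).
(** The bicommutant serves in place of the algebra generated by [d]: an anti-automorphism that fixes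
    [d] stabilizes it for purely formal reasons. *)
Definition bicomm_pred : {pred A} :=
  fun x => [forall y : A, (y * d == d * y) ==> (x * y == y * x)].
Lemma bicommP x : reflect (forall y, y * d = d * y -> x * y = y * x) (bicomm_pred x).
Proof.
apply: (iffP forallP) => [h y /eqP yd|h y]; last by apply/implyP=> /eqP/h ->.
by have /implyP/(_ yd)/eqP := h y.
Qed.
Fact bicomm_subring : subring_closed bicomm_pred.
Proof.
split=> [|x y /bicommP hx /bicommP hy|x y /bicommP hx /bicommP hy]; apply/bicommP=> z zd.
- by rewrite mul1r mulr1.
- by rewrite mulrBl mulrBr hx ?hy.
- by rewrite -mulrA hy // mulrA hx // mulrA.
Qed.
HB.instance Definition _ := GRing.isSubringClosed.Build A bicomm_pred bicomm_subring.
Definition bicomm := {x : A | bicomm_pred x}.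
HB.instance Definition _ := SubType.on bicomm.
HB.instance Definition _ := [Finite of bicomm by <:].
HB.instance Definition _ := [SubChoice_isSubNzRing of bicomm by <:].
(** Since [d] commutes with itself, each element of the bicommutant commutes with [d], hence with
    every other element of the bicommutant. *)
Fact bicomm_mulC : commutative (@GRing.mul bicomm).
Proof.
move=> x y; apply/val_inj => /=.
have /bicommP xP := valP x; have /bicommP yP := valP y.
by apply: (xP); apply: yP.
Qed.
HB.instance Definition _ := GRing.PzRing_hasCommutativeMul.Build bicomm bicomm_mulC.
HB.instance Definition _ := FinRing.isNzRing.Build bicomm.
End Bicommutant.

(** * Forms with equal asymmetry *)

Section Star.
Variables (K : fieldType) (th : {rmorphism K -> K}).
Definition star m n (M : 'M[K]_(m, n)) : 'M[K]_(n, m) := map_mx th M^T.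

Lemma starM m n p (M : 'M_(m, n)) (N : 'M_(n, p)) :
  star (M *m N) = star N *m star M.
Proof. by rewrite /star trmx_mul map_mxM. Qed.

Lemma starK : involutive th -> forall m n, cancel (@star m n) (@star n m).
Proof. by move=> thK m n M; apply/matrixP=> i j; rewrite !mxE thK. Qed.

Lemma star_unit n (M : 'M_n) : (star M \in unitmx) = (M \in unitmx).
Proof. by rewrite map_unitmx unitmx_tr. Qed.

Lemma star_inv n (M : 'M_n) : star (invmx M) = invmx (star M).
Proof. by rewrite /star trmx_inv map_invmx. Qed.

Lemma star_inj m n : injective (@star m n).
Proof.
by move=> M N /matrixP e; apply/matrixP=> i j; have := e j i; rewrite !mxE => /fmorph_inj.
Qed.

(** A change of basis acts on the matrix of a form by congruence, on its asymmetry by conjugation.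
    The double star is asked to fix [V] because [th] need not be an involution on the whole of [K];
    it is one on F_{q^2}. *)
Lemma star_asymmetry n (V C : 'M_n) :
  star (star V) = V -> V \in unitmx -> C \in unitmx ->
  star (V *m C *m star V) *m invmx (V *m C *m star V) =
  V *m (star C *m invmx C) *m invmx V.
Proof.
move=> sV UV UC; have UVCV : V *m C *m star V \in unitmx.
  by rewrite !unitmx_mul star_unit UV UC.
apply: (can_inj (mulmxK UVCV)); rewrite mulmxKV // !starM sV !mulmxA.
by rewrite mulmxKV // mulmxKV.
Qed.
End Star.

Section Asymmetry.
Variables (K : finFieldType) (th : {rmorphism K -> K}) (al : K) (n : nat).
Hypotheses (thK : involutive th) (th_al : th al != al).
Variables C0 C1 : 'M[K]_n.+1.
Hypotheses (UC0 : C0 \in unitmx) (UC1 : C1 \in unitmx).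
Hypothesis asymE : star th C0 *m invmx C0 = star th C1 *m invmx C1.

Let D : 'M[K]_n.+1 := C1 *m invmx C0.
(** This is the adjoint for the form u C0 v^* on row vectors: u [adj M] pairs with v as u does with
    v M. *)
Let adj (M : 'M[K]_n.+1) := C0 *m star th M *m invmx C0.

Let adjM M N : adj (M *m N) = adj N *m adj M.
Proof. by rewrite /adj starM !mulmxA mulmxKV. Qed.

Let adj_inj : injective adj.
Proof.
move=> M N /(can_inj (mulmxKV UC0)) e; apply: (star_inj (th := th)).
by rewrite -[LHS](mulKmx UC0) e mulKmx.
Qed.

(** Equality of the asymmetries enters here, as C1^* = C0^* C0^-1 C1. *)
Let adjD : adj D = D.
Proof.
rewrite /adj /D starM star_inv.
have -> : star th C1 = star th C0 *m invmx C0 *m C1 by rewrite asymE mulmxKV.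
by rewrite !mulmxA mulmxKV ?star_unit // mulmxV // mul1mx.
Qed.

Let adj_surj N : exists M, adj M = N.
Proof.
exists (star th (invmx C0 *m N *m C0)).
by rewrite /adj starK // !mulmxA mulmxK // mulmxV // mul1mx.
Qed.

Let A : 'M[K]_n.+1 := star th C0 *m invmx C0.

(** The square of [adj] is conjugation by the asymmetry [A]. Since [adj] fixes [D], [A] commutes
    with [D], hence with the bicommutant of [D], on which [adj] is therefore an involution. *)
Let adj_adj M : A *m adj (adj M) = M *m A.
Proof.
rewrite /adj !starM starK // star_inv /A !mulmxA mulmxKV // mulmxV ?star_unit //.
by rewrite mul1mx.
Qed.

(** A bijective anti-automorphism fixing [D] preserves the centralizer of [D], hence also the
    bicommutant. *)
Let bicomm_adj x : bicomm_pred D x -> bicomm_pred D (adj x).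
Proof.
move=> /bicommP xP; apply/bicommP => y; have [z <-] := adj_surj y.
have adjMr u v : adj u * adj v = adj (v * u) by rewrite -!mulmxE adjM.
by rewrite -{1 2}adjD !adjMr => /adj_inj zD; rewrite xP.
Qed.

Let adjK x : bicomm_pred D x -> adj (adj x) = x.
Proof.
move=> /bicommP xP; have UA : A \in unitmx by rewrite unitmx_mul star_unit UC0 unitmx_inv.
apply: (can_inj (mulKmx UA)); rewrite adj_adj !mulmxE; apply: xP.
by have := adj_adj D; rewrite !adjD !mulmxE.
Qed.

Lemma equiv_of_eq_asymmetry : exists Y, Y *m C0 *m star th Y = C1.
Proof.
pose R := bicomm D.
pose s (x : R) : R := Sub (adj (val x)) (bicomm_adj (valP x)).
have sB : zmod_morphism s.
  move=> x y; apply: val_inj; rewrite /= /adj /star.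
  by rewrite linearB map_mxB mulmxBr mulmxBl.
have sM : monoid_morphism s.
  split=> [|x y]; apply: val_inj.
    by rewrite /= /adj /star -[1]/(1%:M) trmx1 map_mx1 mulmx1 mulmxV.
  (* Commutativity of the bicommutant turns the anti-automorphism into a ring morphism. *)
  by rewrite [x * y]mulrC; apply: adjM.
pose sZ := GRing.isZmodMorphism.Build R R s sB.
pose sR := GRing.isMonoidMorphism.Build R R s sM.
pose s' : {rmorphism R -> R} := HB.pack s sZ sR.
have sK : involutive s' by move=> x; apply: val_inj; apply: adjK (valP x).
have bic_scal (a : K) : bicomm_pred D a%:M.
  by apply/bicommP => y _; rewrite -!mulmxE scalar_mxC.
have bicD : bicomm_pred D D by apply/bicommP => y ->.
pose a' : R := Sub al%:M (bic_scal al).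
pose d : R := Sub D bicD.
have unitR (x : R) (y : K) : val x = y%:M -> y != 0 -> x \is a GRing.unit.
  move=> xy y0; apply/unitrP; exists (Sub y^-1%:M (bic_scal y^-1)).
  by split; apply: val_inj; rewrite /= xy -mulmxE -scalar_mxM ?mulVf ?mulfV.
have Ud : d \is a GRing.unit.
  have UD : D \is a GRing.unit
    by rewrite -[_ \is a _]/(D \in unitmx) unitmx_mul UC1 unitmx_inv.
  have bicDV : bicomm_pred D D^-1 by apply/bicommP => y yD; rewrite commrV.
  apply/unitrP; exists (Sub D^-1 bicDV).
  by split; apply: val_inj; rewrite /= ?mulVr ?mulrV.
(* On scalar matrices [adj] acts as [th], so a scalar moved by [th] yields the unit that Hilbert 90
   asks for. *)
have Ua : a' - s' a' \is a GRing.unit.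
  apply: (unitR _ (al - th al)); last by rewrite subr_eq0 eq_sym.
  by rewrite /= /adj /star tr_scalar_mx map_scalar_mx scalar_mxC mulmxK // raddfB.
have s_d : s' d = d by apply: val_inj; apply: adjD.
have [y /(congr1 val) /= yy] := unit_norm_surj sK Ua Ud s_d.
exists (val y); move: yy; rewrite -mulmxE /adj !mulmxA.
by move/(congr1 (mulmx^~ C0)); rewrite /D !mulmxKV.
Qed.

End Asymmetry.

(** * Descent of similarity *)

Section HomCounting.
Variable K : finFieldType.

(** These are the K[t]-module morphisms from K^m to K^n, on row vectors, with t acting as [U] and
    [V]. *)
Definition intw m n (U : 'M[K]_m) (V : 'M[K]_n) : {set 'M[K]_(m, n)} :=
  [set X | U *m X == X *m V].
Definition inj_intw m n (U : 'M[K]_m) (V : 'M[K]_n) : {set 'M[K]_(m, n)} :=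
  [set X in intw U V | row_free X].
(** A subspace is represented by its canonical generating matrix, so that one can sum over
    subspaces. *)
Definition ker_intw m n (U : 'M[K]_m) (V : 'M[K]_n) (N : 'M[K]_m) :
  {set 'M[K]_(m, n)} := [set X in intw U V | <<kermx X>>%MS == N].

(* [U'] is the endomorphism that [U] induces on the quotient by [N]. *)
Lemma card_ker_intw m (U N : 'M[K]_m) :
  <<N>>%MS = N -> stablemx N U ->
  exists U' : 'M[K]_(\rank (cokermx N)), forall n (V : 'M[K]_n),
     #|ker_intw U V N| = #|inj_intw U' V|.
Proof.
(* [pi] is the projection of K^m onto its quotient by the row space of [N], and [rho] is a section
   of it. *)
move=> genN /submxP[W NU]; set pi := col_base (cokermx N).
have /row_fullP[rho rho_pi] : row_full pi := col_base_full _.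
have pi0 k (x : 'M_(k, m)) : (x *m pi == 0) = (x <= N)%MS.
  rewrite submxE -[in RHS](mulmx_base (cokermx N)) mulmxA.
  by rewrite [RHS]mulmx_free_eq0 ?row_base_free.
have Npi : N *m pi = 0 by apply/eqP; rewrite pi0.
have /submxP[Z splitZ] : (1%:M - pi *m rho <= N)%MS.
  by rewrite -pi0 mulmxBl mul1mx -mulmxA rho_pi mulmx1 subrr.
have piK n (X : 'M_(m, n)) : N *m X = 0 -> pi *m (rho *m X) = X.
  move=> NX; apply/esym/eqP; rewrite mulmxA -subr_eq0 -{1}(mul1mx X) -mulmxBl.
  by rewrite splitZ -mulmxA NX mulmx0.
exists (rho *m U *m pi) => n V.
have Upi : U *m pi = pi *m (rho *m U *m pi).
  by rewrite -!(mulmxA rho) piK // mulmxA NU -mulmxA Npi mulmx0.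
have pi_inj : injective (mulmx pi : 'M_(_, n) -> _).
  by apply: (can_inj (g := mulmx rho)) => y; rewrite mulmxA rho_pi mul1mx.
(* Composition with [pi] maps the injective intertwiners on the quotient bijectively to those with
   kernel [N]. *)
rewrite -(card_imset _ pi_inj); congr #|pred_of_set _|.
apply/setP=> X; apply/idP/imsetP.
  rewrite !inE => /andP[/eqP UX /eqP kX].
  have kerX k (x : 'M_(k, m)) : (x *m X == 0) = (x <= N)%MS.
    by rewrite -sub_kermx -kX genmxE.
  have NX : N *m X = 0 by apply/eqP; rewrite kerX.
  exists (rho *m X); rewrite ?piK // !inE; apply/andP; split.
    by rewrite -(mulmxA _ pi) piK // -!mulmxA UX.
  rewrite -kermx_eq0; set x := kermx _.
  have : x *m rho *m X = 0 by rewrite -mulmxA mulmx_ker.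
  move/eqP; rewrite kerX -pi0 -mulmxA rho_pi mulmx1 //.
case=> Y; rewrite !inE => /andP[/eqP UY freeY] ->.
apply/andP; split; first by rewrite mulmxA Upi -(mulmxA pi) UY mulmxA.
rewrite -[X in _ == X]genN; apply/eqP/eq_genmx/eqmxP/andP.
have subE k (x : 'M_(k, m)) : (x <= kermx (pi *m Y))%MS = (x <= N)%MS.
  rewrite sub_kermx -pi0 mulmxA.
  by rewrite mulmx_free_eq0.
by rewrite -subE submx_refl subE submx_refl.
Qed.

Lemma sum_ker_intw m n (U : 'M[K]_m) (V : 'M[K]_n) :
  #|intw U V| = (#|inj_intw U V| +
     \sum_(N | [&& <<N>>%MS == N, stablemx N U & N != (0 : 'M_m)%R]) #|ker_intw U V N|)%N.
Proof.
pose P (N : 'M[K]_m) := (<<N>>%MS == N) && stablemx N U.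
rewrite -sum1_card (partition_big (fun X => <<kermx X>>%MS) P) /=; last first.
  move=> X; rewrite inE => /eqP UX; rewrite /P genmx_id eqxx /=.
  by rewrite (eqmxMr _ (genmxE _)) genmxE sub_kermx -mulmxA UX mulmxA mulmx_ker mul0mx.
rewrite (bigD1 0) /=; last by rewrite /P genmx0 eqxx stable0mx.
congr (_ + _)%N.
  rewrite sum1dep_card; apply: eq_card => X; rewrite !inE; congr (_ && _).
  by rewrite -kermx_eq0 -!submx0 genmxE.
apply: eq_big => [N|N _]; first by rewrite /P andbA.
by rewrite sum1dep_card; apply: eq_card => X; rewrite !inE.
Qed.

(** By induction on [m]: intertwiners with a nonzero kernel are injective ones on a smaller
    quotient, hence equinumerous for [V1] and [V2]. Removing them from equal totals leaves the
    injective ones. *)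
Lemma eq_inj_intw n (V1 V2 : 'M[K]_n) :
  (forall m (U : 'M[K]_m), #|intw U V1| = #|intw U V2|) ->
  forall m (U : 'M[K]_m), #|inj_intw U V1| = #|inj_intw U V2|.
Proof.
move=> eqI m; elim/ltn_ind: m => m IH U.
have := eqI m U; rewrite !sum_ker_intw.
set s1 := (\sum_(N | _) _)%N; set s2 := (\sum_(N | _) _)%N.
suff -> : s1 = s2 by move/addIn.
apply: eq_bigr => N /and3P[/eqP gN stN N0].
have [U' E] := card_ker_intw gN stN; rewrite !E IH //.
rewrite mxrank_coker ltn_subrL lt0n mxrank_eq0 N0 lt0n.
(* Only [0 < m] remains, and a nonzero [N] excludes [m = 0]. *)
by case: (m) N N0 {gN stN E U'} => // N; rewrite [N]flatmx0 eqxx.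
Qed.

(** Take [U = V1]: the identity is an injective intertwiner to [V1], so there is also one to [V2],
    and being square it is invertible. *)
Lemma similar_of_card_intw n (V1 V2 : 'M[K]_n) :
  (forall m (U : 'M[K]_m), #|intw U V1| = #|intw U V2|) ->
  exists2 X : 'M[K]_n, X \in unitmx & V1 *m X = X *m V2.
Proof.
move=> /eq_inj_intw/(_ _ V1) eqI.
have : (0 < #|inj_intw V1 V2|)%N.
  rewrite -eqI; apply/card_gt0P; exists 1%:M.
  by rewrite !inE mulmx1 mul1mx eqxx row_free_unit unitmx1.
case/card_gt0P=> X; rewrite !inE row_free_unit => /andP[/eqP VX UX].
by exists X.
Qed.

End HomCounting.

Definition intw_mx (K : fieldType) m n (U : 'M[K]_m) (V : 'M[K]_n) :=
  lin_mx (mulmx U : 'M_(m, n) -> _) - lin_mx (mulmxr V).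

Lemma card_intw (K : finFieldType) m n (U : 'M[K]_m) (V : 'M[K]_n) :
  #|intw U V| = (#|K| ^ \rank (kermx (intw_mx U V)))%N.
Proof.
rewrite -card_rowg -(card_imset _ (can_inj mxvecK)).
congr #|pred_of_set _|; apply/setP=> v; rewrite mem_rowg sub_kermx.
rewrite -[v]vec_mxK (mem_imset _ _ (can_inj mxvecK)) inE -subr_eq0.
by rewrite mulmxBr !mul_vec_lin -linearB /= mxvec_eq0.
Qed.

Lemma similar_descent (K F : finFieldType) (f : {rmorphism K -> F}) n
    (V1 V2 : 'M[K]_n) (Z : 'M[F]_n) :
  Z \in unitmx -> map_mx f V1 *m Z = Z *m map_mx f V2 ->
  exists2 X : 'M[K]_n, X \in unitmx & V1 *m X = X *m V2.
Proof.
move=> UZ VZ; apply: similar_of_card_intw => m U.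
(* Over [F], right multiplication by [Z] is a bijection between the two sets. *)
have cardF : #|intw (map_mx f U) (map_mx f V1)| = #|intw (map_mx f U) (map_mx f V2)|.
  rewrite -(card_imset _ (can_inj (mulmxK UZ))).
  congr #|pred_of_set _|; apply/setP=> X.
  rewrite -[X](mulmxKV UZ) (mem_imset _ _ (can_inj (mulmxK UZ))) !inE mulmxA.
  rewrite -(mulmxA _ Z) -VZ mulmxA -subr_eq0 -[RHS]subr_eq0.
  rewrite (mulmxA (map_mx f U) _ Z) -mulmxBl.
  by rewrite [RHS]mulmx_free_eq0 ?row_free_unit // mulmxA.
have rankF (V : 'M[K]_n) : \rank (kermx (intw_mx (map_mx f U) (map_mx f V))) = \rank (kermx (intw_mx U V)).
  rewrite -(mxrank_map f (kermx _)) map_kermx; congr (\rank (kermx _)).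
  by rewrite /intw_mx map_mxB; congr (_ - _); apply/esym/map_lin_mx => X; rewrite /= map_mxM.
rewrite !card_intw -!rankF; congr (_ ^ _)%N; apply/eqP.
by move: cardF => /eqP; rewrite !card_intw eqn_exp2l // finNzRing_gt1.
Qed.

(** * Moore matrices *)

Section Twist.
Variables (F : finFieldType) (phi : {rmorphism F -> F}).
Local Notation K := (fixed (phi \o phi)).

Fact twist_subproof (x : K) : fixp (phi \o phi) (phi (val x)).
Proof. by apply/eqP => /=; have /eqP /= -> := valP x. Qed.
Definition twist (x : K) : K := Sub (phi (val x)) (twist_subproof x).
Fact twist_zmod : zmod_morphism twist.
Proof. by move=> x y; apply: val_inj; rewrite /= rmorphB. Qed.
Fact twist_monoid : monoid_morphism twist.
Proof.
by split=> [|x y]; apply: val_inj; rewrite /= (rmorph1, rmorphM).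
Qed.
HB.instance Definition _ := GRing.isZmodMorphism.Build K K twist twist_zmod.
HB.instance Definition _ := GRing.isMonoidMorphism.Build K K twist twist_monoid.
Lemma twistK : involutive twist.
Proof. by move=> x; apply: val_inj => /=; have /eqP := valP x. Qed.

Lemma map_star m n (M : 'M[K]_(m, n)) :
  map_mx val (star twist M) = star phi (map_mx val M).
Proof. by apply/matrixP => i j; rewrite !mxE. Qed.

Lemma fixed_mxP m n (M : 'M[F]_(m, n)) : (forall i j, fixp (phi \o phi) (M i j)) ->
  exists M' : 'M[K]_(m, n), M = map_mx val M'.
Proof.
move=> h; exists (\matrix_(i, j) Sub (M i j) (h i j)).
by apply/matrixP=> i j; rewrite !mxE.
Qed.
End Twist.

Lemma frobenius_rmorphism (R : comNzRingType) p k :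
  p \in [pchar R] -> exists f : {rmorphism R -> R}, forall x, f x = x ^+ (p ^ k).
Proof.
move=> pR; elim: k => [|k [f fE]]; first by exists idfun => x; rewrite expr1.
exists (pFrobenius_aut pR \o f) => x.
by rewrite /= fE pFrobenius_autE -exprM expnSr.
Qed.

Lemma conj_mxE (F : fieldType) n (X A B : 'M[F]_n) : X \in unitmx ->
  X *m A *m invmx X = B <-> X *m A = B *m X.
Proof.
by move=> UX; split=> [<-|->]; rewrite ?mulmxKV ?mulmxK.
Qed.

Lemma intertwine_inv (F : fieldType) n (A Q B : 'M[F]_n) : B \in unitmx ->
  A *m B = B *m Q -> Q *m invmx B = invmx B *m A.
Proof.
move=> UB AB; apply: (can_inj (mulmxK UB)); apply: (can_inj (mulKmx UB)).
by rewrite mulmxKV // -AB !mulmxA mulmxV // mul1mx.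
Qed.

Lemma intertwine_conj (F : fieldType) n (A0 A1 Q0 Q1 B0 B1 X : 'M[F]_n) :
  B1 \in unitmx -> A0 *m B0 = B0 *m Q0 -> A1 *m B1 = B1 *m Q1 ->
  X *m A0 = A1 *m X ->
  invmx B1 *m X *m B0 *m Q0 = Q1 *m (invmx B1 *m X *m B0).
Proof.
move=> UB1 E0 /(intertwine_inv UB1) E1 XA.
by rewrite -mulmxA -E0 !mulmxA E1 -(mulmxA _ X A0) XA !mulmxA.
Qed.

(** * Coefficient matrices of the forms and their asymmetries *)

Section Sesquilinear.
Variables (q n' : nat) (F : finFieldType) (phi : {rmorphism F -> F}).
Local Notation n := n'.+1.
Hypothesis phiE : forall x, phi x = x ^+ q.
Hypothesis hF : #|F| = (q ^ (2 * n))%N.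
Local Notation K := (fixed (phi \o phi)).

Lemma mxstarE (M : 'M[F]_n) : mxstar q M = star phi M.
Proof. by apply/matrixP=> i j; rewrite /mxstar !mxE phiE. Qed.

Lemma inFq2E x : inFq2 q x = fixp (phi \o phi) x.
Proof. by rewrite /inFq2 /fixp /= !phiE -exprM mulnn. Qed.

Lemma frobE i (x : F) : x ^+ (q ^ (2 * i)) = iter i (phi \o phi) x.
Proof.
elim: i => [|i IH]; first by rewrite muln0 expr1.
by rewrite iterS -IH /= !phiE -!exprM mulnS addnC expnD -?mulnA mulnn.
Qed.

Lemma frobD i j (x : F) : x ^+ (q ^ (2 * (i + j))) = (x ^+ (q ^ (2 * i))) ^+ (q ^ (2 * j)).
Proof. by rewrite -exprM -expnD mulnDr. Qed.

Lemma frob_mod i (x : F) : x ^+ (q ^ (2 * (i %% n))) = x ^+ (q ^ (2 * i)).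
Proof.
rewrite [in RHS](divn_eq i n) addnC frobD.
elim: (i %/ n)%N => [|m IH]; first by rewrite muln0 expr1.
by rewrite (mulSnr m) frobD -IH -hF expf_card.
Qed.

Lemma frob_fixed i (c : F) : inFq2 q c -> c ^+ (q ^ (2 * i)) = c.
Proof.
rewrite inFq2E => /eqP /= hc; rewrite frobE.
by elim: i => // i IH; rewrite iterS IH.
Qed.

Lemma frob_is_additive i : {morph (fun x : F => x ^+ (q ^ (2 * i))) : x y / x + y}.
Proof.
by move=> x y; rewrite !frobE; elim: i => // i IH; rewrite !iterS IH /= !rmorphD.
Qed.

Lemma frob_sum i (I : finType) (G : I -> F) :
  (\sum_j G j) ^+ (q ^ (2 * i)) = \sum_j G j ^+ (q ^ (2 * i)).
Proof.
apply: (big_morph _ (frob_is_additive i)).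
by rewrite frobE; elim: i => // i IH; rewrite iterS IH /= !rmorph0.
Qed.

Definition frob_row (u : F) : 'rV[F]_n := \row_k u ^+ (q ^ (2 * k)).
Definition moore (b : 'I_n -> F) : 'M[F]_n := \matrix_(i, k) b i ^+ (q ^ (2 * k)).

Lemma row_moore b i : row i (moore b) = frob_row (b i).
Proof. by apply/rowP => k; rewrite !mxE. Qed.

Lemma sigmaL_mx a u v :
  sigmaL q n a u v = (frob_row u *m ML q n a *m star phi (frob_row v)) 0 0.
Proof.
rewrite -mulmxA mxE; apply: eq_bigr => i _.
rewrite !mxE exprMn; congr (_ * _); rewrite frob_sum.
(* After raising to the power [q ^ (2 * i)], term k of the polynomial carries the conjugate of index
   k + i. The cyclic shift by [- i] brings it to column k of [ML]. *)
rewrite (reindex_inj (addIr (- i))); apply: eq_bigr => k _.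
rewrite !mxE exprMn phiE; congr (_ * _).
  by rewrite /= modnDmr addnBA // ltnW.
have kE : ((((k - i)%R : 'I_n) + i) %% n = k)%N by rewrite -{2}(subrK i k).
by rewrite -frobD -frob_mod kE -!exprM mulnC.
Qed.

Lemma coefmxE a b : coefmx q a b = moore b *m ML q n a *m star phi (moore b).
Proof.
apply/matrixP=> i j; rewrite mxE sigmaL_mx -!row_moore.
rewrite !mxE; apply: eq_bigr => k _; rewrite !mxE; congr (_ * _).
by apply: eq_bigr => l _; rewrite !mxE.
Qed.

(** The transpositions cancel, leaving the power [q ^ 2] on each entry, which shifts the columns
    cyclically. This is the origin of [Pmx]. *)
Lemma star_star_moore b : star phi (star phi (moore b)) = moore b *m Pmx F n.
Proof.
apply/matrixP=> i k; rewrite !mxE (bigD1 (inord (k.+1 %% n))) //= big1 => [|l nl].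
  rewrite !mxE inordK ?ltn_pmod // eqxx mulr1 addr0 frob_mod !phiE.
  by rewrite -!exprM mulnS addnC expnD -?mulnA mulnn.
rewrite !mxE; case: eqP => [lk|]; last by rewrite mulr0.
by case/eqP: nl; apply: val_inj; rewrite /= inordK ?ltn_pmod.
Qed.

(** The Moore matrix is a factor of the nonsingular coefficient matrix, hence itself nonsingular. *)
Lemma coefmx_asym a b : coefmx q a b \in unitmx ->
  moore b \in unitmx /\
  mxstar q (coefmx q a b) *m invmx (coefmx q a b) *m moore b =
  moore b *m (Pmx F n *m mxstar q (ML q n a) *m invmx (ML q n a)).
Proof.
move=> UC; have := UC; rewrite {1}coefmxE !unitmx_mul => /andP[/andP[UB UM] UBs].
split=> //; rewrite -mulmxA.
have -> : invmx (coefmx q a b) *m moore b =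
    invmx (star phi (moore b)) *m invmx (ML q n a).
  apply: (can_inj (mulKmx UC)); rewrite mulKVmx // {1}coefmxE !mulmxA.
  by rewrite mulmxK // mulmxK.
rewrite coefmxE !mxstarE !starM star_star_moore !mulmxA; congr (_ *m _).
by rewrite mulmxK.
Qed.

Lemma frob_row_sum (I : finType) (c b : I -> F) : (forall i, inFq2 q (c i)) ->
  frob_row (\sum_i c i * b i) = \sum_i c i *: frob_row (b i).
Proof.
move=> hc; apply/rowP=> k; rewrite mxE summxE frob_sum.
by apply: eq_bigr => i _; rewrite !mxE exprMn (frob_fixed k (hc i)).
Qed.

Lemma moore_mul (T : 'M[K]_n) b :
  moore (fun i => \sum_j val (T i j) * b j) = map_mx val T *m moore b.
Proof.
apply/row_matrixP=> i; rewrite row_moore row_mul frob_row_sum; last first.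
  by move=> j; rewrite inFq2E (valP (T i j)).
rewrite mulmx_sum_row; apply: eq_bigr => j _.
by rewrite row_moore !mxE.
Qed.

(** Traces lie in F_{q^2}: the power [q ^ 2] permutes their summands cyclically. *)
Lemma coefmx_fixed a b : exists C : 'M[K]_n, coefmx q a b = map_mx val C.
Proof.
apply: fixed_mxP => i j; rewrite mxE -inFq2E /sigmaL /Tr.
set x := b i * _; apply/eqP.
have -> y : y ^+ (q ^ 2) = y ^+ (q ^ (2 * 1)) by rewrite muln1.
rewrite frob_sum; under eq_bigr => k _ do rewrite -frobD -frob_mod.
rewrite [RHS](reindex_inj (@ordS_inj n)); apply: eq_bigr => k _.
by rewrite /= addn1.
Qed.

(** Otherwise all of [K] consists of roots of X^q - X, so [K] has at most q elements, and a spanning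
    family of size n bounds [#|F|] by q^n < q^(2n). *)
Lemma twist_nontrivial (b : 'I_n -> F) : is_basis_Fq2 q b -> exists al : K, twist al != al.
Proof.
case=> _ span_b.
have q_gt1 : (1 < q)%N.
  have := finNzRing_gt1 F; rewrite hF; case: (q) => [|[|//]].
    by rewrite exp0n.
  by rewrite exp1n.
suff : ~~ [forall al : K, twist al == al] by rewrite negb_forall => /existsP[al]; exists al.
apply/negP => /forallP triv.
have leK : (#|{: K}| <= q)%N.
  pose P : {poly F} := 'X^q - 'X.
  have szP : size P = q.+1.
    by rewrite size_polyDl size_polyXn // size_polyN size_polyX.
  have P0 : P != 0 by rewrite -size_poly_eq0 szP.
  rewrite -ltnS -szP cardE -(size_map val); apply: max_poly_roots => //.
    apply/allP=> _ /mapP[x _ ->]; rewrite rootE !hornerE -phiE subr_eq0.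
    by have := triv x; rewrite -(inj_eq val_inj).
  by rewrite (map_inj_uniq val_inj) enum_uniq.
have : (#|F| <= #|{ffun 'I_n -> K}|)%N.
  pose g (c : {ffun 'I_n -> K}) : F := \sum_i val (c i) * b i.
  have -> : #|F| = #|g @: setT|.
    rewrite -cardsT; congr #|pred_of_set _|; apply/setP=> x; rewrite inE.
    apply/esym/imsetP; have [c hc ->] := span_b x.
    have hc' i : fixp (phi \o phi) (c i) by rewrite -inFq2E.
    exists [ffun i => Sub (c i) (hc' i)] => //.
    by apply: eq_bigr => i _; rewrite ffunE.
  by rewrite (leq_trans (leq_imset_card _ _)) // cardsT.
rewrite card_ffun card_ord hF => le_qK.
have : (q ^ (2 * n) <= q ^ n)%N by rewrite (leq_trans le_qK) // leq_exp2r.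
by rewrite leq_exp2l // leqNgt mul2n -addnn -[X in (X < _)%N]addn0 ltn_add2l.
Qed.

(** * The implications between the three conditions *)

Lemma sesq_equiv_conj a0 a1 (b0 b1 : 'I_n -> F) :
  is_basis_Fq2 q b1 -> coefmx q a0 b0 \in unitmx -> coefmx q a1 b1 \in unitmx ->
  sesq_equiv q n a0 a1 ->
  conj_in (inFq2 q)
    (mxstar q (coefmx q a0 b0) *m invmx (coefmx q a0 b0))
    (mxstar q (coefmx q a1 b1) *m invmx (coefmx q a1 b1)).
Proof.
move=> [_ span1] U0 U1 [tau [_ _ _ tauE]].
(* The matrix [T] of [tau] in the two bases makes C0 congruent to C1 over F_{q^2}. *)
have [T tau_b] : exists T : 'M[K]_n, forall i, tau (b0 i) = \sum_j val (T i j) * b1 j.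
  have coord i : exists c : {ffun 'I_n -> K}, tau (b0 i) == \sum_j val (c j) * b1 j.
    have [c hc e] := span1 (tau (b0 i)).
    have hc' j : fixp (phi \o phi) (c j) by rewrite -inFq2E.
    exists [ffun j => Sub (c j) (hc' j)]; rewrite e; apply/eqP.
    by apply: eq_bigr => j _; rewrite ffunE.
  exists (\matrix_(i, j) xchoose (coord i) j) => i.
  rewrite (eqP (xchooseP (coord i))); apply: eq_bigr => j _.
  by rewrite mxE.
pose V := map_mx val T : 'M[F]_n.
have C0E : coefmx q a0 b0 = V *m coefmx q a1 b1 *m star phi V.
  have -> : coefmx q a0 b0 = coefmx q a1 (fun i => \sum_j val (T i j) * b1 j).
    by apply/matrixP=> i j; rewrite !mxE tauE !tau_b.
  by rewrite !coefmxE moore_mul starM !mulmxA.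
have UV : V \in unitmx.
  by move: U0; rewrite C0E !unitmx_mul -andbA => /andP[].
have sV : star phi (star phi V) = V by rewrite -!map_star starK //; apply: twistK.
exists (invmx V).
  split; first by rewrite unitmx_inv.
  by move=> i j; rewrite /V -map_invmx mxE inFq2E; apply: valP.
rewrite C0E !mxstarE star_asymmetry // invmxK !mulmxA mulVmx // mul1mx.
by rewrite mulmxKV.
Qed.

Lemma conj_coefmx_ML a0 a1 (b0 b1 : 'I_n -> F) (S : F -> bool) :
  coefmx q a0 b0 \in unitmx -> coefmx q a1 b1 \in unitmx ->
  conj_in S
    (mxstar q (coefmx q a0 b0) *m invmx (coefmx q a0 b0))
    (mxstar q (coefmx q a1 b1) *m invmx (coefmx q a1 b1)) ->
  conj_in (fun=> true)
    (Pmx F n *m mxstar q (ML q n a0) *m invmx (ML q n a0))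
    (Pmx F n *m mxstar q (ML q n a1) *m invmx (ML q n a1)).
Proof.
move=> /coefmx_asym[UB0 E0] /coefmx_asym[UB1 E1] [X [UX _] /(conj_mxE _ _ UX) XE].
exists (invmx (moore b1) *m X *m moore b0).
  by rewrite !unitmx_mul unitmx_inv UB1 UX UB0.
apply/conj_mxE; first by rewrite !unitmx_mul unitmx_inv UB1 UX UB0.
exact: intertwine_conj UB1 E0 E1 XE.
Qed.

Lemma conj_ML_sesq_equiv a0 a1 (b0 b1 : 'I_n -> F) :
  is_basis_Fq2 q b0 ->
  coefmx q a0 b0 \in unitmx -> coefmx q a1 b1 \in unitmx ->
  conj_in (fun=> true)
    (Pmx F n *m mxstar q (ML q n a0) *m invmx (ML q n a0))
    (Pmx F n *m mxstar q (ML q n a1) *m invmx (ML q n a1)) ->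
  sesq_equiv q n a0 a1.
Proof.
move=> basis0 U0 U1 [Z [UZ _] /(conj_mxE _ _ UZ) ZE].
have [UB0 E0] := coefmx_asym U0; have [UB1 E1] := coefmx_asym U1.
have [C0 C0E] := coefmx_fixed a0 b0; have [C1 C1E] := coefmx_fixed a1 b1.
have UC0 : C0 \in unitmx by move: U0; rewrite C0E map_unitmx.
have UC1 : C1 \in unitmx by move: U1; rewrite C1E map_unitmx.
pose asym (C : 'M[K]_n) := star (twist (phi := phi)) C *m invmx C.
have asymE a b C : coefmx q a b = map_mx val C ->
    mxstar q (coefmx q a b) *m invmx (coefmx q a b) = map_mx val (asym C).
  by move=> ->; rewrite map_mxM map_star map_invmx mxstarE.
pose W := moore b1 *m Z *m invmx (moore b0).
have UW : W \in unitmx by rewrite !unitmx_mul unitmx_inv UB1 UZ UB0.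
have WE : map_mx val (asym C1) *m W = W *m map_mx val (asym C0).
  rewrite -(asymE _ _ _ C0E) -(asymE _ _ _ C1E) /W.
  have UB1' : invmx (moore b1) \in unitmx by rewrite unitmx_inv.
  have := intertwine_conj UB1' (intertwine_inv UB0 E0) (intertwine_inv UB1 E1) ZE.
  by rewrite invmxK => ->.
have [X UX XE] := similar_descent UW WE.
have [al al_nt] := twist_nontrivial basis0.
have sX : star (twist (phi := phi)) (star (twist (phi := phi)) X) = X.
  by rewrite starK //; apply: twistK.
have UC0' : X *m C0 *m star (twist (phi := phi)) X \in unitmx.
  by rewrite !unitmx_mul star_unit UX UC0.
(* Congruence by the descended [X] reduces to the case of equal asymmetries. *)
have asym_eq : asym (X *m C0 *m star (twist (phi := phi)) X) = asym C1.
  by rewrite /asym star_asymmetry // -/(asym C0) -/(asym C1) -XE mulmxK.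
have [Y YE] := equiv_of_eq_asymmetry (@twistK _ phi) al_nt UC0' UC1 asym_eq.
have [P UP PE] : exists2 P, P \in unitmx & P *m C0 *m star (twist (phi := phi)) P = C1.
  exists (Y *m X); last by rewrite starM -YE !mulmxA.
  by move: UC1; rewrite -YE unitmx_mul => /andP[]; rewrite !unitmx_mul UX => /andP[-> _].
pose V : 'M[F]_n := map_mx val (invmx P).
have UV : V \in unitmx by rewrite map_unitmx unitmx_inv.
have VE : coefmx q a0 b0 = V *m coefmx q a1 b1 *m star phi V.
  rewrite C0E C1E /V -map_star -!map_mxM -PE star_inv !mulmxA mulVmx // mul1mx.
  by rewrite mulmxK // star_unit.
(* [frob_row u *m invmx (moore b0)] is the row of coordinates of [u] in the basis [b0], so [tau] is
   the map with matrix [V] in the bases [b0] and [b1]. *)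
pose crd u := frob_row u *m invmx (moore b0) *m V.
pose tau u := \sum_j crd u 0 j * b1 j.
have crd_fixed u j : inFq2 q (crd u 0 j).
  have [c hc ->] := basis0.2 u.
  have hc' i : fixp (phi \o phi) (c i) by rewrite -inFq2E.
  have -> : crd (\sum_i c i * b0 i) =
      map_mx val ((\row_i Sub (c i) (hc' i)) *m invmx P).
    rewrite map_mxM /crd; congr (_ *m _); apply: (can_inj (mulmxK UB0)).
    rewrite mulmxKV // frob_row_sum // mulmx_sum_row.
    by apply: eq_bigr => i _; rewrite row_moore !mxE.
  by rewrite mxE inFq2E; apply: valP.
have row_tau u : frob_row (tau u) = crd u *m moore b1.
  rewrite frob_row_sum // mulmx_sum_row.
  by apply: eq_bigr => j _; rewrite row_moore.
(* Entry 0 of the row is [u] itself. The properties of [tau] can thus be checked on rows of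
   conjugates. *)
have frob_row_inj : injective frob_row.
  by move=> u v /rowP/(_ 0); rewrite !mxE !frobE.
have frob_rowD : {morph frob_row : u v / u + v}.
  by move=> u v; apply/rowP=> k; rewrite !mxE frob_is_additive.
have frob_rowZ c u : inFq2 q c -> frob_row (c * u) = c *: frob_row u.
  by move=> hc; apply/rowP=> k; rewrite !mxE exprMn (frob_fixed k hc).
exists tau; split.
- apply: injF_bij => u v /(congr1 frob_row); rewrite !row_tau.
  move/(can_inj (mulmxK UB1))/(can_inj (mulmxK UV)).
  by move/(can_inj (mulmxKV UB0))/frob_row_inj.
- by move=> u v; apply: frob_row_inj; rewrite frob_rowD !row_tau /crd frob_rowD !mulmxDl.
- move=> c u hc; apply: frob_row_inj.
  by rewrite frob_rowZ // !row_tau /crd frob_rowZ // -!scalemxAl.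
move=> u v; rewrite !sigmaL_mx !row_tau /crd.
have -> : ML q n a0 = invmx (moore b0) *m coefmx q a0 b0 *m invmx (star phi (moore b0)).
  by rewrite coefmxE !mulmxA mulVmx // mul1mx mulmxK // star_unit.
by rewrite VE coefmxE !starM star_inv !mulmxA.
Qed.

End Sesquilinear.

Theorem theorem2p4 (q n : nat) (F : finFieldType)
    (hq : exists p k : nat, [/\ prime p, (0 < k)%N & q = (p ^ k)%N])
    (hn : (0 < n)%N) (hF : #|F| = (q ^ (2 * n))%N)
    (a0 a1 : nat -> F) (b0 b1 : 'I_n -> F)
    (hb0 : is_basis_Fq2 q b0) (hb1 : is_basis_Fq2 q b1)
    (hC0 : coefmx q a0 b0 \in unitmx) (hC1 : coefmx q a1 b1 \in unitmx) :
  let C0 := coefmx q a0 b0 in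
  let C1 := coefmx q a1 b1 in
  [<-> sesq_equiv q n a0 a1;
       conj_in (inFq2 q) (mxstar q C0 *m invmx C0) (mxstar q C1 *m invmx C1);
       conj_in (fun _ => true)
         (Pmx F n *m mxstar q (ML q n a0) *m invmx (ML q n a0))
         (Pmx F n *m mxstar q (ML q n a1) *m invmx (ML q n a1))].
Proof.
case: hq => p [k [p_pr k_gt0 qE]].
have pF : p \in [pchar F].
  by apply: (card_finPcharP (n := (k * (2 * n))%N)); rewrite // expnM -qE.
have [phi phiE'] := frobenius_rmorphism k pF.
have phiE x : phi x = x ^+ q by rewrite phiE' qE.
case: n hn hF b0 b1 hb0 hb1 hC0 hC1 => // n _ hF b0 b1 hb0 hb1 hC0 hC1 C0 C1.
tfae.
- exact: (sesq_equiv_conj phiE hF hb1 hC0 hC1).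
- exact: (conj_coefmx_ML phiE hF hC0 hC1).
- exact: (conj_ML_sesq_equiv phiE hF hb0 hC0 hC1).
Qed.
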